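(* Let $(T,R)$ be a problem instance with a set $T$ of $n$ tasks whose weights $w_1,\dots,w_n$ all lie in the range $[1,w_{\max}]$, and a set $R$ of $m$ resources with delays $d_1\le\dots\le d_m$. Then $$\max_{N\in\mathcal{N}} C(N)\;\le\; 4\,w_{\max}\,\min_{A\in\mathcal{A}} C(A),$$ where $\mathcal{A}$ is the set of all assignments and $\mathcal{N}$ is the set of all Nash assignments of $(T,R)$.
   Context: A problem instance $(T,R)$ consists of a set $R=\{1,\dots,m\}$ of resources with delays (positive reals) $d_1\le\dots\le d_m$ and a set $T=\{1,\dots,n\}$ of tasks with real weights $w_1,\dots,w_n\ge 1$. An assignment is a vector $A=(A_1,\dots,A_n)\in\mathcal{A}=\{1,\dots,m\}^n$ (task $i$ is assigned to resource $A_i$). The load of resource $\ell$ in $A$ is $L(\ell,A)=d_\ell\sum_{i\in T:\,A_i=\ell}w_i$, the load of task $i$ is $L(A_i,A)$, and the social cost is $C(A)=\sum_{i\in T}L(A_i,A)$. An assignment $A$ is a Nash assignment if for every task $i$ and every resource $\ell$ we have $L(A_i,A)\le L(\ell,A')$, where $A'$ is obtained from $A$ by re-assigning task $i$ to resource $\ell$ and making no other change. $\mathcal{N}=\mathcal{N}(T,R)$ is the set of all Nash assignments; it is known to be nonempty. *)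

(* Defs.v *)
From mathcomp Require Import all_boot all_order all_algebra.
From mathcomp Require Import reals.

Set Implicit Arguments.
Unset Strict Implicit.
Unset Printing Implicit Defensive.

Import Order.TTheory GRing.Theory Num.Theory.
Local Open Scope ring_scope.

Section SelfishTaskAllocation.

(* Tasks are 'I_n.  Resources are 'I_m.+1, so that there is at least one and
   the set of assignments is nonempty. *)
Variables (R : realType) (n m : nat).
Variables (w : 'I_n -> R) (d : 'I_m.+1 -> R).

Definition assignment : Type := {ffun 'I_n -> 'I_m.+1}.

Implicit Types (A N : assignment) (i : 'I_n) (l : 'I_m.+1).

Definition load l A : R := d l * \sum_(i < n | A i == l) w i.

Definition cost A : R := \sum_(i < n) load (A i) A.

Definition reassign A i l : assignment :=
  [ffun j => if j == i then l else A j].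

Definition nash A : bool :=
  [forall i, forall l, load (A i) A <= load l (reassign A i l)].

(* The default value 0 is harmless, because costs are nonnegative when weights
   and delays are: see max_nash_cost_ge and max_nash_cost_attained. *)
Definition max_nash_cost : R :=
  \big[Num.max/0]_(N : {ffun 'I_n -> 'I_m.+1} | nash N) cost N.

(* The default value is itself the cost of an assignment: see min_cost_le and
   min_cost_attained. *)
Definition min_cost : R :=
  \big[Num.min/cost [ffun=> ord0]]_(A : {ffun 'I_n -> 'I_m.+1}) cost A.

Lemma max_nash_cost_ge N : nash N -> cost N <= max_nash_cost.
Proof. by move=> nashN; apply: (le_bigmax_cond _ cost nashN). Qed.

Lemma max_nash_cost_attained N0 :
    (forall i, 0 <= w i) -> (forall l, 0 <= d l) -> nash N0 ->
  exists2 N, nash N & max_nash_cost = cost N.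
Proof.
move=> w_ge0 d_ge0 nashN0.
have cost_ge0 A : 0 <= cost A.
  by apply: sumr_ge0 => i _; rewrite mulr_ge0 // sumr_ge0.
rewrite /max_nash_cost (bigmax_eq_arg _ _ _ _ nashN0) //.
by case: arg_maxP => // N nashN _; exists N.
Qed.

Lemma min_cost_le A : min_cost <= cost A.
Proof. exact: bigmin_le. Qed.

Lemma min_cost_attained : exists A, min_cost = cost A.
Proof.
apply: (big_ind (fun x => exists A, x = cost A)); first by exists [ffun=> ord0].
  by move=> x y [A ->] [B ->]; rewrite minEle; case: ifP; [exists A | exists B].
by move=> A _; exists A.
Qed.

End SelfishTaskAllocation.

(* Main.v *)
(** Weigh every task by [w i].  Multiplying the Nash inequality of task [i]
    against its resource in [A] by [w i] and summing over the tasks gives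
    [X <= sum_l d_l V_l W_l + Y], where [W_l] and [V_l] are the total weights on
    [l] in [N] and [A], [X = sum_l d_l W_l^2] and [Y = sum_l d_l V_l^2].  Since
    [2 V W <= V^2 + W^2], this yields [X <= 3 Y].  The weights lie in
    [[1, wmax]], so [C(N) <= X] and [Y <= wmax C(A)]: the constant is in fact
    at most [3 wmax]. *)
Require Import Defs.
From mathcomp Require Import all_boot all_order all_algebra.
From mathcomp Require Import reals.
From mathcomp Require Import ring lra.

Import Order.TTheory GRing.Theory Num.Theory.
Local Open Scope ring_scope.

(** The quantities [X] and [Y], kept as sums over tasks so that Nash inequalities apply termwise. *)
Definition weighted_cost {R : realType} {n m : nat} (w : 'I_n -> R)
    (d : 'I_m.+1 -> R) (A : assignment n m) : R :=
  \sum_(i < n) w i * load w d (A i) A.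

Lemma sum_weight_by_resource (R : realType) (n m : nat) (w : 'I_n -> R)
    (A : assignment n m) (F : 'I_m.+1 -> R) :
  \sum_(i < n) w i * F (A i) =
  \sum_(l < m.+1) F l * \sum_(i < n | A i == l) w i.
Proof.
rewrite (partition_big A predT) //=; apply: eq_bigr => l _.
by rewrite mulr_sumr; apply: eq_bigr => i /eqP ->; rewrite mulrC.
Qed.

(** Equality holds unless [i] already uses [l]; then the right side counts [w i] twice. *)
Lemma load_reassign_le (R : realType) (n m : nat) (w : 'I_n -> R)
    (d : 'I_m.+1 -> R) (A : assignment n m) (i : 'I_n) (l : 'I_m.+1) :
    (forall j, 0 <= w j) -> 0 <= d l ->
  load w d l (reassign A i l) <= load w d l A + d l * w i.
Proof.
move=> w_ge0 d_ge0; rewrite /load -mulrDr ler_wpM2l //.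
rewrite (bigD1 i) /= ?ffunE ?eqxx // addrC lerD2r.
rewrite big_mkcond [leRHS]big_mkcond; apply: ler_sum => j _.
by rewrite ffunE; case: (j == i); rewrite ?andbF ?andbT //=; case: ifP.
Qed.

Lemma nash_weighted_cost_le (R : realType) (n m : nat) (w : 'I_n -> R)
    (d : 'I_m.+1 -> R) (N A : assignment n m) :
    (forall i, 0 <= w i) -> (forall l, 0 <= d l) -> nash w d N ->
  weighted_cost w d N <= 3 * weighted_cost w d A.
Proof.
move=> w_ge0 d_ge0 /forallP nashN.
have deviation : weighted_cost w d N <=
    \sum_(i < n) w i * load w d (A i) N + weighted_cost w d A.
  rewrite -big_split; apply: ler_sum => i _ /=; rewrite -mulrDr ler_wpM2l //.
  apply: le_trans (forallP (nashN i) (A i)) _.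
  apply: le_trans (load_reassign_le _ _ _ w d N i (A i) w_ge0 (d_ge0 _)) _.
  (* Task [i] is itself on [A i] in [A], so its weight is part of that load. *)
  rewrite lerD2l ler_wpM2l // (bigD1 i) //= lerDl sumr_ge0 //.
have cross : 2 * \sum_(i < n) w i * load w d (A i) N <=
    weighted_cost w d N + weighted_cost w d A.
  rewrite /weighted_cost (sum_weight_by_resource _ _ _ w A (load w d ^~ N)).
  rewrite (sum_weight_by_resource _ _ _ w N (load w d ^~ N)).
  rewrite (sum_weight_by_resource _ _ _ w A (load w d ^~ A)).
  rewrite -big_split mulr_sumr; apply: ler_sum => l _; rewrite /load /=.
  set W := \sum_(i < n | N i == l) _; set V := \sum_(i < n | A i == l) _.
  rewrite -subr_ge0.
  have -> : d l * W * W + d l * V * V - 2 * (d l * W * V) =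
      d l * (W - V) ^+ 2 by ring.
  by rewrite mulr_ge0 ?sqr_ge0.
(* Doubling [deviation] and inserting [cross] gives [2 X <= X + Y + 2 Y]. *)
lra.
Qed.

Theorem theorem2p5 (R : realType) (n m : nat)
  (w : 'I_n -> R) (d : 'I_m.+1 -> R) (wmax : R)
  (w_range : forall i : 'I_n, 1 <= w i <= wmax)
  (d_pos : forall l : 'I_m.+1, 0 < d l)
  (d_sorted : forall k l : 'I_m.+1, (k <= l)%N -> d k <= d l) :
  max_nash_cost w d <= 4 * wmax * min_cost w d.
Proof.
have w_ge1 i : 1 <= w i by case/andP: (w_range i).
have w_ge0 i : 0 <= w i by apply: le_trans (w_ge1 i).
have d_ge0 l : 0 <= d l by apply: ltW.
have load_ge0 l A : 0 <= load w d l A by rewrite mulr_ge0 ?sumr_ge0.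
have [A ->] := min_cost_attained w d.
have wA_ge0 : 0 <= weighted_cost w d A.
  by apply: sumr_ge0 => i _; rewrite mulr_ge0.
have wA_le : weighted_cost w d A <= wmax * cost w d A.
  rewrite mulr_sumr; apply: ler_sum => i _; rewrite ler_wpM2r //.
  by case/andP: (w_range i).
(* The default [0] of the maximum is bounded too, by [wA_ge0] and [wA_le]. *)
apply: bigmax_le => [|N nashN]; first lra.
have costN_le : cost w d N <= weighted_cost w d N.
  by apply: ler_sum => i _; rewrite ler_peMl.
have := nash_weighted_cost_le _ _ _ w d N A w_ge0 d_ge0 nashN.
lra.
Qed.
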